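(* Consider the pseudo-marginal MCMC algorithm with importance sample size $K\ge 1$. Let $\boldsymbol{\theta}$ be the current value with associated importance samples $\boldsymbol{x}^1,\dots,\boldsymbol{x}^K\in\mathbb{R}^N$ (drawn from $\hat\pi(\cdot\mid\boldsymbol{\theta},\boldsymbol{b})$), and let $\boldsymbol{\theta}'$ be the proposed value (with $r(\boldsymbol{\theta}'\mid\boldsymbol{\theta})>0$) with associated importance samples $\boldsymbol{x}'^1,\dots,\boldsymbol{x}'^K\in\mathbb{R}^N$ (drawn from $\hat\pi(\cdot\mid\boldsymbol{\theta}',\boldsymbol{b})$). Then the acceptance ratio $$\rho_4(\boldsymbol{\theta}';\boldsymbol{\theta})=\min\left\{1,\frac{\pi^K(\boldsymbol{\theta}'\mid\boldsymbol{b})\,r(\boldsymbol{\theta}\mid\boldsymbol{\theta}')}{\pi^K(\boldsymbol{\theta}\mid\boldsymbol{b})\,r(\boldsymbol{\theta}'\mid\boldsymbol{\theta})}\right\}$$ simplifies to $$\rho_4(\boldsymbol{\theta}';\boldsymbol{\theta})=\min\left\{1,\frac{z_K(\boldsymbol{\theta}')\,\pi(\boldsymbol{\theta}'\mid\boldsymbol{b})\,r(\boldsymbol{\theta}\mid\boldsymbol{\theta}')}{z_K(\boldsymbol{\theta})\,\pi(\boldsymbol{\theta}\mid\boldsymbol{b})\,r(\boldsymbol{\theta}'\mid\boldsymbol{\theta})}\right\},$$ where $z_K(\boldsymbol{\theta})=\frac1K\sum_{j=1}^K z(\boldsymbol{x}^j,\boldsymbol{\theta})$ and $z_K(\boldsymbol{\theta}')=\frac1K\sum_{j=1}^K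 z(\boldsymbol{x}'^j,\boldsymbol{\theta}')$.
   Context: Let $\boldsymbol{A}\in\mathbb{R}^{M\times N}$, $\boldsymbol{b}\in\mathbb{R}^M$, let $\boldsymbol{\Gamma}_{\rm prior}\in\mathbb{R}^{N\times N}$ be symmetric positive definite, and let $\boldsymbol{\theta}=(\mu,\sigma)\in(0,\infty)^2$. The hyperprior density is $\pi(\boldsymbol{\theta})\propto\mu^{\alpha_\mu-1}\sigma^{\alpha_\sigma-1}\exp(-\beta_\mu\mu-\beta_\sigma\sigma)$ with $\alpha_\mu,\alpha_\sigma,\beta_\mu,\beta_\sigma>0$ (independent Gamma distributions). The joint posterior density on $\mathbb{R}^N\times(0,\infty)^2$ is $$\pi(\boldsymbol{x},\boldsymbol{\theta}\mid\boldsymbol{b})\propto\mu^{M/2}\sigma^{N/2}\pi(\boldsymbol{\theta})\exp\left(-\tfrac{\mu}{2}\|\boldsymbol{A}\boldsymbol{x}-\boldsymbol{b}\|_2^2-\tfrac{\sigma}{2}\boldsymbol{x}^\top\boldsymbol{\Gamma}_{\rm prior}^{-1}\boldsymbol{x}\right),$$ and $\pi(\boldsymbol{\theta}\mid\boldsymbol{b})=\int_{\mathbb{R}^N}\pi(\boldsymbol{x},\boldsymbol{\theta}\mid\boldsymbol{b})\,d\boldsymbol{x}$ is its marginal density. Put $\boldsymbol{\Gamma}_{\rm cond}^{-1}(\boldsymbol{\theta})=\mu\boldsymbol{A}^\top\boldsymbol{A}+\sigma\boldsymbol{\Gamma}_{\rm prior}^{-1}$. For each $\boldsymbol{\theta}$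 let $\widehat{\boldsymbol{\Gamma}}_{\rm cond}(\boldsymbol{\theta})$ be a symmetric positive definite $N\times N$ matrix (an approximation of $\boldsymbol{\Gamma}_{\rm cond}(\boldsymbol{\theta})$), put $\hat{\boldsymbol{x}}_{\rm cond}(\boldsymbol{\theta})=\mu\widehat{\boldsymbol{\Gamma}}_{\rm cond}(\boldsymbol{\theta})\boldsymbol{A}^\top\boldsymbol{b}$, and let $\hat\pi(\boldsymbol{x}\mid\boldsymbol{\theta},\boldsymbol{b})$ be the density of $\mathcal{N}(\hat{\boldsymbol{x}}_{\rm cond}(\boldsymbol{\theta}),\widehat{\boldsymbol{\Gamma}}_{\rm cond}(\boldsymbol{\theta}))$. For each $\boldsymbol{\theta}$, $r(\cdot\mid\boldsymbol{\theta})$ is a proposal probability density on $(0,\infty)^2$. For a value $\boldsymbol{\theta}$ with associated importance samples $\boldsymbol{x}^1,\dots,\boldsymbol{x}^K$, the importance sampling approximation of the marginal is $$\pi^K(\boldsymbol{\theta}\mid\boldsymbol{b})=\frac1K\sum_{j=1}^K\frac{\pi(\boldsymbol{x}^j,\boldsymbol{\theta}\mid\boldsymbol{b})}{\hat\pi(\boldsymbol{x}^j\mid\boldsymbol{\theta},\boldsymbol{b})}.$$ The pseudo-marginal algorithm proposes $\boldsymbol{\theta}'\sim r(\cdot\mid\boldsymbol{\theta})$, draws its importance samples, and accepts $\boldsymbol{\theta}'$ together with its samples with probability $\rho_4(\boldsymbol{\theta}';\boldsymbol{\theta})$, otherwise keeping $\boldsymbol{\theta}$ and its samples. Define $z(\boldsymbol{x},\boldsymbol{\theta})=w(\boldsymbol{x},\boldsymbol{\theta})/M_1(\boldsymbol{\theta})$,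 where $$w(\boldsymbol{x},\boldsymbol{\theta})=\exp\left(-\tfrac12\boldsymbol{x}^\top\big(\boldsymbol{\Gamma}_{\rm cond}^{-1}(\boldsymbol{\theta})-\widehat{\boldsymbol{\Gamma}}_{\rm cond}^{-1}(\boldsymbol{\theta})\big)\boldsymbol{x}\right),$$ $$M_1(\boldsymbol{\theta})=\frac{\exp\left(\tfrac{\mu^2}{2}\boldsymbol{b}^\top\boldsymbol{A}\big(\boldsymbol{\Gamma}_{\rm cond}(\boldsymbol{\theta})-\widehat{\boldsymbol{\Gamma}}_{\rm cond}(\boldsymbol{\theta})\big)\boldsymbol{A}^\top\boldsymbol{b}\right)}{\left(\det\widehat{\boldsymbol{\Gamma}}_{\rm cond}(\boldsymbol{\theta})\cdot\det\boldsymbol{\Gamma}_{\rm cond}^{-1}(\boldsymbol{\theta})\right)^{1/2}}.$$ *)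

(* Defs.v *)
From HB Require Import structures.
From mathcomp Require Import all_boot all_order all_algebra.
From mathcomp Require Import all_classical all_reals all_analysis.

Set Implicit Arguments.
Unset Strict Implicit.
Unset Printing Implicit Defensive.

Import Order.TTheory GRing.Theory Num.Theory.
Import numFieldNormedType.Exports.

Local Open Scope classical_set_scope.
Local Open Scope ring_scope.

(* The library has no n-fold product of sigma-finite measures, hence no
   Lebesgue measure on R^n.  The product of n copies of mu is built on n-tuples
   by recursion: the image of mu \x (n-fold product) under (x, t) |-> x :: t. *)
Section product_measure_tuple.
Context {d} {T : measurableType d} {R : realType}.
Variable mu : {sigma_finite_measure set T -> \bar R}.

Definition tuple_cons n (xt : T * n.-tuple T) : n.+1.-tuple T :=
  [the n.+1.-tuple T of xt.1 :: xt.2].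

Lemma measurable_tuple_cons n : measurable_fun setT (@tuple_cons n).
Proof. exact: measurable_cons. Qed.

Section step.
Variables (n : nat) (m : {sigma_finite_measure set (n.-tuple T) -> \bar R}).

Definition product_tuple_step : set (n.+1.-tuple T) -> \bar R :=
  pushforward (mu \x m)%E (@tuple_cons n).

Let product_tuple_step0 : product_tuple_step set0 = 0%E.
Proof. by rewrite /product_tuple_step /pushforward preimage_set0 measure0. Qed.

Let product_tuple_step_ge0 A : (0 <= product_tuple_step A)%E.
Proof. exact: (measure_ge0 (mu \x m)%E). Qed.

Let product_tuple_step_sigma_additive :
  semi_sigma_additive product_tuple_step.
Proof.
move=> F mF tF mUF; rewrite /product_tuple_step /pushforward preimage_bigcup.
have mp (A : set (n.+1.-tuple T)) : measurable A ->
    measurable (@tuple_cons n @^-1` A).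
  by move=> mA; rewrite -[X in measurable X]setTI; exact: measurable_tuple_cons.
apply: (@measure_semi_sigma_additive _ _ _ (mu \x m)%E).
- by move=> k; exact: mp.
- apply/trivIsetP => /= i j _ _ ij; rewrite -preimage_setI.
  by move/trivIsetP : tF => /(_ _ _ _ _ ij) ->//; rewrite preimage_set0.
- by rewrite -preimage_bigcup; exact: mp.
Qed.

HB.instance Definition _ := isMeasure.Build _ _ _ product_tuple_step
  product_tuple_step0 product_tuple_step_ge0 product_tuple_step_sigma_additive.

Let product_tuple_step_sigma_finite : sigma_finite setT product_tuple_step.
Proof.
have /sigma_finiteP[F [TF ndF Foo]] := sigma_finiteT mu.
have /sigma_finiteP[G [TG ndG Goo]] := sigma_finiteT m.
pose g (t : n.+1.-tuple T) := (tnth t ord0, [tuple of behead t]).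
have mg : measurable_fun setT g.
  apply/measurable_fun_pair; first exact: measurable_tnth.
  exact: measurable_behead.
have gK x : g (tuple_cons x) = x.
  by case: x => x t; rewrite /g /tuple_cons /=; congr pair; exact: val_inj.
exists (fun k => g @^-1` (F k `*` G k)).
  apply/esym/seteqP; split => // t _.
  have [i _ Fi] : (\bigcup_k F k) (g t).1 by rewrite -TF.
  have [j _ Gj] : (\bigcup_k G k) (g t).2 by rewrite -TG.
  exists (maxn i j) => //; split.
  - by move: Fi; exact/subsetPset/ndF/leq_maxl.
  - by move: Gj; exact/subsetPset/ndG/leq_maxr.
move=> k; have [[mF Fk] [mG Gk]] := (Foo k, Goo k).
have mFG : measurable (F k `*` G k) by exact: measurableX.
split; first by rewrite -[X in measurable X]setTI; exact: mg.
rewrite /product_tuple_step /pushforward (_ : _ @^-1` _ = F k `*` G k).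
  by rewrite product_measure1E// lte_mul_pinfty// ge0_fin_numE.
by apply/funext => x; rewrite -[in RHS](gK x).
Qed.

HB.instance Definition _ := Measure_isSigmaFinite.Build _ _ _
  product_tuple_step product_tuple_step_sigma_finite.

End step.

Fixpoint product_tuple n : {sigma_finite_measure set (n.-tuple T) -> \bar R} :=
  if n is n'.+1 then product_tuple_step (product_tuple n')
  else \d_([tuple] : 0.-tuple T).

End product_measure_tuple.

Definition lebesgue_tuple {R : realType} (n : nat) :
    {sigma_finite_measure set (n.-tuple (measurableTypeR R)) -> \bar R} :=
  product_tuple (@lebesgue_measure R) n.

Section matrix_analysis.
Context {R : realType}.

Definition sympd n (S : 'M[R]_n) : Prop :=
  S^T = S /\ forall v : 'cV[R]_n, v != 0 -> 0 < (v^T *m S *m v) 0 0.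

(* The norm `|_| of the library on matrices is the sup norm. *)
Definition l2norm n (v : 'cV[R]_n) : R := Num.sqrt (\sum_i v i 0 ^+ 2).

Definition gaussian_pdf n (m : 'cV[R]_n) (S : 'M[R]_n) (x : 'cV[R]_n) : R :=
  expR (- (((x - m)^T *m invmx S *m (x - m)) 0 0 / 2))
    / Num.sqrt ((2 * pi) ^+ n * \det S).

Definition col_of_tuple n (t : n.-tuple R) : 'cV[R]_n := \col_i tnth t i.

End matrix_analysis.

(* The pair theta stands for (mu, sigma). *)
Definition quadrant {R : realType} : set (R * R) :=
  [set theta | 0 < theta.1 /\ 0 < theta.2].

Definition lebesgue2 {R : realType} :
    {measure set (measurableTypeR R * measurableTypeR R) -> \bar R} :=
  (@lebesgue_measure R \x @lebesgue_measure R)%E.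

Definition is_pdf_on d (T : measurableType d) (R : realType)
    (nu : {measure set T -> \bar R}) (D : set T) (f : T -> R) : Prop :=
  [/\ measurable_fun D f, (forall t, D t -> 0 <= f t) &
      (\int[nu]_(t in D) (f t)%:E = 1)%E].

Section model.
Context {R : realType} {M N : nat}.
Variables (A : 'M[R]_(M, N)) (b : 'cV[R]_M) (Gprior : 'M[R]_N).
Variables (amu asigma bmu bsigma : R).

(* A density given up to a constant is its kernel divided by the integral of
   that kernel; here the integral is finite and positive. *)
Definition hyperprior_kernel (theta : R * R) : R :=
  theta.1 `^ (amu - 1) * theta.2 `^ (asigma - 1) *
  expR (- (bmu * theta.1) - bsigma * theta.2).

Definition hyperprior (theta : R * R) : R :=
  hyperprior_kernel theta /
  \int[lebesgue2]_(s in quadrant) hyperprior_kernel s.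

Definition posterior_kernel (x : 'cV[R]_N) (theta : R * R) : R :=
  theta.1 `^ (M%:R / 2) * theta.2 `^ (N%:R / 2) * hyperprior theta *
  expR (- (theta.1 / 2 * l2norm (A *m x - b) ^+ 2)
        - theta.2 / 2 * (x^T *m invmx Gprior *m x) 0 0).

Definition posterior (x : 'cV[R]_N) (theta : R * R) : R :=
  posterior_kernel x theta /
  \int[(lebesgue2 \x lebesgue_tuple N)%E]_(s in quadrant `*` setT)
    posterior_kernel (col_of_tuple s.2) s.1.

Definition marginal (theta : R * R) : R :=
  \int[lebesgue_tuple N]_t posterior (col_of_tuple t) theta.

Definition precision_cond (theta : R * R) : 'M[R]_N :=
  theta.1 *: (A^T *m A) + theta.2 *: invmx Gprior.

Definition cov_cond (theta : R * R) : 'M[R]_N := invmx (precision_cond theta).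

Section approximation.
Variable Ghat : R * R -> 'M[R]_N.

Definition mean_hat (theta : R * R) : 'cV[R]_N :=
  theta.1 *: (Ghat theta *m A^T *m b).

Definition importance_pdf (x : 'cV[R]_N) (theta : R * R) : R :=
  gaussian_pdf (mean_hat theta) (Ghat theta) x.

Definition marginal_IS K (xs : 'I_K -> 'cV[R]_N) (theta : R * R) : R :=
  K%:R^-1 * \sum_(j < K) (posterior (xs j) theta / importance_pdf (xs j) theta).

Definition weight (x : 'cV[R]_N) (theta : R * R) : R :=
  expR (- ((x^T *m (precision_cond theta - invmx (Ghat theta)) *m x) 0 0 / 2)).

Definition weight_M1 (theta : R * R) : R :=
  expR (theta.1 ^+ 2 / 2 *
        (b^T *m A *m (cov_cond theta - Ghat theta) *m A^T *m b) 0 0)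
    / Num.sqrt (\det (Ghat theta) * \det (precision_cond theta)).

Definition z_weight (x : 'cV[R]_N) (theta : R * R) : R :=
  weight x theta / weight_M1 theta.

Definition z_avg K (xs : 'I_K -> 'cV[R]_N) (theta : R * R) : R :=
  K%:R^-1 * \sum_(j < K) z_weight (xs j) theta.

(* r theta' theta is the proposal density r(theta' | theta); xs and xs' are the
   importance samples attached to theta and theta'. *)
Definition rho4 (r : R * R -> R * R -> R) K
    (xs' : 'I_K -> 'cV[R]_N) (theta' : R * R)
    (xs : 'I_K -> 'cV[R]_N) (theta : R * R) : R :=
  Num.min 1 (marginal_IS xs' theta' * r theta theta' /
             (marginal_IS xs theta * r theta' theta)).

End approximation.
End model.

(* Main.v *)
(* For fixed theta, the posterior kernel is a constant times
   exp(-(x - u)^T P (x - u) / 2) with P = Gamma_cond^-1 and P u = mu A^T b, so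
   the Gaussian integral gives its marginal.  The approximate Gaussian satisfies
   Ghat^-1 m = mu A^T b for its mean m; in the quotient of the two densities the
   linear terms therefore cancel, and
     posterior(x, theta) / importance_pdf(x, theta) = z(x, theta) marginal(theta)
   holds pointwise.  Averaging over the samples gives the claim. *)

Require Import Defs.
From HB Require Import structures.
From mathcomp Require Import all_boot all_order all_algebra.
From mathcomp Require Import all_classical all_reals all_analysis.
From mathcomp Require Import measurable_realfun ring.

Set Implicit Arguments.
Unset Strict Implicit.
Unset Printing Implicit Defensive.

Import Order.TTheory GRing.Theory Num.Theory.
Import numFieldNormedType.Exports.

Local Open Scope classical_set_scope.
Local Open Scope ring_scope.

(** * Schur complements and positive definite matrices *)

Section schur_complement.
Context {R : realType}.

Definition qform n (S : 'M[R]_n) (v : 'cV[R]_n) : R := (v^T *m S *m v) 0 0.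

Definition schur n (S : 'M[R]_(1 + n)) : 'M[R]_n :=
  drsubmx S - (S 0 0)^-1 *: (dlsubmx S *m ursubmx S).

Lemma ulsubmx_scalar n (S : 'M[R]_(1 + n)) : ulsubmx S = (S 0 0)%:M.
Proof.
rewrite [LHS]mx11_scalar !mxE; congr (S _ _)%:M; exact: val_inj.
Qed.

(** Block elimination: [S] is a unipotent lower block triangular matrix times an upper one with
    diagonal blocks [S 0 0] and [schur S]. *)
Lemma det_schur n (S : 'M[R]_(1 + n)) :
  S 0 0 != 0 -> \det S = S 0 0 * \det (schur S).
Proof.
move=> p0; rewrite -[in LHS](submxK S) ulsubmx_scalar.
set p : R := S 0 0; set u := ursubmx S; set l := dlsubmx S.
have -> : block_mx p%:M u l (drsubmx S) =
    block_mx 1%:M 0 (p^-1 *: l) 1%:M *m block_mx p%:M u 0 (schur S).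
  rewrite mulmx_block !mul1mx !mul0mx !addr0 mul_mx_scalar scalerA.
  by rewrite mulfV// scale1r -scalemxAl addrC subrK.
by rewrite det_mulmx det_lblock det_ublock !det1 !mul1r det_scalar1.
Qed.

(** Completing the square in the first coordinate [y]; symmetry merges the two cross terms. *)
Lemma qform_schur n (S : 'M[R]_(1 + n)) (y : R) (v : 'cV[R]_n) :
  S^T = S -> S 0 0 != 0 ->
  qform S (col_mx y%:M v) =
  S 0 0 * (y + (ursubmx S *m v) 0 0 / S 0 0) ^+ 2 + qform (schur S) v.
Proof.
move=> sS p0; rewrite /qform /schur.
have dl : dlsubmx S = (ursubmx S)^T by rewrite trmx_ursub sS.
rewrite -[in LHS](submxK S) ulsubmx_scalar dl.
set p : R := S 0 0; set u := ursubmx S.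
rewrite tr_col_mx mul_row_block mul_row_col tr_scalar_mx.
have uv : v^T *m u^T = ((u *m v) 0 0)%:M.
  by rewrite -trmx_mul [u *m v]mx11_scalar tr_scalar_mx !mxE eqxx.
rewrite !mulmxDl -!mulmxA mulmxBl mulmxBr -scalemxAl -scalemxAr.
rewrite !mulmxA uv -!mulmxA [u *m v]mx11_scalar -!scalar_mxM.
rewrite !mxE eqxx !mulr1n.
set s := \sum_j u _ _ * _; set q := \sum_j _ * _ j _.
by field.
Qed.

Lemma sympd_diag_gt0 n (S : 'M[R]_(1 + n)) : sympd S -> 0 < S 0 0.
Proof.
move=> [_ pS]; have /pS : delta_mx 0 0 != 0 :> 'cV[R]_(1 + n).
  by apply/eqP => /matrixP/(_ 0 0)/eqP; rewrite !mxE !eqxx oner_eq0.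
by rewrite trmx_delta -rowE -colE !mxE.
Qed.

Lemma sympd_schur n (S : 'M[R]_(1 + n)) : sympd S -> sympd (schur S).
Proof.
move=> SS; have p0 := sympd_diag_gt0 SS; case: SS => sS pS; split.
  rewrite /schur linearB linearZ /= trmx_mul trmx_drsub trmx_dlsub.
  by rewrite trmx_ursub sS.
move=> v v0.
(* This first coordinate makes the square vanish, so the form of [schur S] at [v] is a value of the
   form of [S]. *)
have := qform_schur (- ((ursubmx S *m v) 0 0 / S 0 0)) v sS (lt0r_neq0 p0).
rewrite addNr expr0n mulr0 add0r /qform => <-; apply: pS.
by apply: contra_neq v0 => /(congr1 dsubmx); rewrite col_mxKd linear0.
Qed.

Lemma det_sympd_gt0 n (S : 'M[R]_n) : sympd S -> 0 < \det S.
Proof.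
elim: n S => [|n IH] S SS; first by rewrite det_mx00.
have p0 := sympd_diag_gt0 (n := n) SS.
rewrite (@det_schur n S (lt0r_neq0 p0)) mulr_gt0//.
exact/IH/(@sympd_schur n S).
Qed.

Lemma sympd_unit n (S : 'M[R]_n) : sympd S -> S \in unitmx.
Proof. by move=> /det_sympd_gt0/lt0r_neq0; rewrite unitmxE unitfE. Qed.

Lemma invmx_sym n (S : 'M[R]_n) : S^T = S -> (invmx S)^T = invmx S.
Proof. by move=> sS; rewrite trmx_inv sS. Qed.

Lemma sympd_inv n (S : 'M[R]_n) : sympd S -> sympd (invmx S).
Proof.
move=> SS; have uS := sympd_unit SS; case: SS => sS pS.
split=> [|v v0]; first exact: invmx_sym.
(* The form of [invmx S] at [v] is the form of [S] at [invmx S *m v]. *)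
have := pS (invmx S *m v); rewrite trmx_mul invmx_sym// mulmxKV// mulmxA.
apply; apply: contra_neq v0 => /(congr1 (mulmx S)).
by rewrite mulKVmx// mulmx0.
Qed.

Lemma sympdD_psd n (S T : 'M[R]_n) : S^T = S -> (forall v, 0 <= qform S v) ->
  sympd T -> sympd (S + T).
Proof.
move=> sS pS [sT pT]; split=> [|v v0]; first by rewrite linearD/= sS sT.
by rewrite mulmxDr mulmxDl mxE ltr_wpDl ?pT//; exact: pS.
Qed.

Lemma sympdZ n (S : 'M[R]_n) (a : R) : 0 < a -> sympd S -> sympd (a *: S).
Proof.
move=> a0 [sS pS]; split=> [|v v0]; first by rewrite linearZ/= sS.
by rewrite -scalemxAr -scalemxAl mxE mulr_gt0// pS.
Qed.

Lemma l2norm_sqr n (v : 'cV[R]_n) : l2norm v ^+ 2 = (v^T *m v) 0 0.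
Proof.
rewrite sqr_sqrtr ?sumr_ge0// => [|i _]; last exact: sqr_ge0.
by rewrite mxE; apply: eq_bigr => i _; rewrite mxE expr2.
Qed.

Lemma qform_gram_ge0 m n (A : 'M[R]_(m, n)) (v : 'cV[R]_n) :
  0 <= qform (A^T *m A) v.
Proof.
by rewrite /qform !mulmxA -trmx_mul -mulmxA -l2norm_sqr sqr_ge0.
Qed.

End schur_complement.

(** * The Gaussian integral in n dimensions *)

Section gaussian_integral.
Context {R : realType}.

(** Up to its peak value, the integrand is the normal density with mean [- m] and variance
    [p^-1]. *)
Lemma integral_gauss_scaled (p m : R) : 0 < p ->
  (\int[@lebesgue_measure R]_x (expR (- (p * (x + m) ^+ 2 / 2)))%:E =
   (Num.sqrt (2 * pi / p))%:E)%E.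
Proof.
move=> p0; pose s : R := Num.sqrt p^-1.
have s0 : s != 0 by rewrite gt_eqF// sqrtr_gt0 invr_gt0.
have s2 : s ^+ 2 = p^-1 by rewrite sqr_sqrtr// invr_ge0 ltW.
have peakE : (normal_peak s)^-1 = Num.sqrt (2 * pi / p).
  by rewrite /normal_peak invrK s2 -mulr_natl; congr Num.sqrt; ring.
have gaussE x : expR (- (p * (x + m) ^+ 2 / 2)) =
    Num.sqrt (2 * pi / p) * normal_pdf (- m) s x.
  rewrite /normal_pdf (negbTE s0) -peakE mulKf; last first.
    by rewrite gt_eqF// normal_peak_gt0.
  by rewrite /normal_fun opprK s2; congr expR; field; rewrite gt_eqF.
under eq_integral do rewrite gaussE EFinM.
rewrite ge0_integralZl_EFin ?sqrtr_ge0 ?integral_normal_pdf ?mule1//.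
- by move=> x _; rewrite lee_fin normal_pdf_ge0.
- by apply/measurable_EFinP; exact: measurable_normal_pdf.
Qed.

Lemma measurable_qform n (S : 'M[R]_n) (u : 'cV[R]_n) :
  measurable_fun setT
    (fun t : n.-tuple (measurableTypeR R) => qform S (col_of_tuple t - u)).
Proof.
have -> : (fun t : n.-tuple (measurableTypeR R) => qform S (col_of_tuple t - u)) =
    (fun t => \sum_j (\sum_i (tnth t i - u i 0) * S i j) * (tnth t j - u j 0)).
  apply/funext => t; rewrite /qform mxE; apply: eq_bigr => j _.
  rewrite !mxE; congr (_ * _); apply: eq_bigr => i _; by rewrite !mxE.
have mt (i : 'I_n) : measurable_fun setT
    (fun t : n.-tuple (measurableTypeR R) => (tnth t i : R) - u i 0).
  by apply: measurable_funB => //; exact: measurable_tnth.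
apply: measurable_sum => j; apply: measurable_funM => //.
by apply: measurable_sum => i; exact: measurable_funM.
Qed.

Lemma measurable_expR_qform n (S : 'M[R]_n) (u : 'cV[R]_n) :
  measurable_fun setT (fun t : n.-tuple (measurableTypeR R) =>
    expR (- (qform S (col_of_tuple t - u) / 2))).
Proof.
apply: measurableT_comp => //; apply: measurableT_comp => //.
by apply: measurable_funM => //; exact: measurable_qform.
Qed.

(** Turns the recursion on tuples behind [lebesgue_tuple] into the block form that [qform_schur]
    expects. *)
Lemma col_of_tuple_cons n (xt : R * n.-tuple R) (u : 'cV[R]_(1 + n)) :
  col_of_tuple (tuple_cons (xt : measurableTypeR R * _)) - u =
  col_mx (xt.1 - u 0 0)%:M (col_of_tuple xt.2 - dsubmx u).
Proof.
apply/colP => i; case: (@split_ordP 1 n i) => j ->.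
  rewrite [RHS](@col_mxEu R 1 n 1) !mxE [j]ord1 eqxx mulr1n; congr (_ - u _ _).
  exact: val_inj.
by rewrite [RHS](@col_mxEd R 1 n 1) !mxE; congr (_ - _); rewrite !(tnth_nth 0).
Qed.

(* Integrating out the first coordinate leaves the same problem for the Schur
   complement of the first diagonal entry. *)
Lemma integral_gauss_qform n (S : 'M[R]_n) (u : 'cV[R]_n) : sympd S ->
  (\int[lebesgue_tuple n]_t
     (expR (- (qform S (col_of_tuple t - u) / 2)))%:E =
   (Num.sqrt ((2 * pi) ^+ n / \det S))%:E)%E.
Proof.
elim: n S u => [|n IH] S u SS.
  (* In dimension 0 the measure is the Dirac mass at the empty tuple, and both sides equal 1. *)
  rewrite integral_dirac//; last first.
    by apply/measurable_EFinP; exact: measurable_expR_qform.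
  rewrite diracT mul1e det_mx00 expr0 divr1 sqrtr1 /qform mxE big_ord0.
  by rewrite mul0r oppr0 expR0.
have p0 := sympd_diag_gt0 (n := n) SS.
have sS := SS.1.
pose f (t : n.+1.-tuple (measurableTypeR R)) :=
  (expR (- (qform S (col_of_tuple t - u) / 2)))%:E.
have mf : measurable_fun setT f.
  by apply/measurable_EFinP; exact: measurable_expR_qform.
have f0 t : (0 <= f t)%E by rewrite lee_fin expR_ge0.
have mc := @measurable_tuple_cons _ (measurableTypeR R) n.
(* The measure is the image of a product; Tonelli then makes the first coordinate the inner
   variable. *)
rewrite [LHS](ge0_integral_pushforward mc
  (lebesgue_measure \x lebesgue_tuple n)%E measurableT mf)//.
rewrite preimage_setT fubini_tonelli2; last 2 first.
- exact: (measurableT_comp mf mc).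
- by move=> x; exact: f0.
rewrite /fubini_G.
pose v t : 'cV[R]_n := col_of_tuple t - dsubmx (u : 'cV_(1 + n)).
pose k := Num.sqrt (2 * pi / S 0 0).
pose g t := expR (- (qform (schur (S : 'M[R]_(1 + n))) (v t) / 2)).
have g0 t : 0 <= g t by exact: expR_ge0.
have inner t : (\int[@lebesgue_measure R]_x
    (f \o @tuple_cons _ (measurableTypeR R) n) (x, t) = k%:E * (g t)%:E)%E.
  (* The shift comes from the centre [u] and from completing the square. It depends on [t] alone, so
     the inner integral of the square is the constant [k]. *)
  rewrite -(integral_gauss_scaled
    (- u 0 0 + (ursubmx (S : 'M[R]_(1 + n)) *m v t) 0 0 / S 0 0) p0).
  rewrite -ge0_integralZr//; last by rewrite lee_fin.
    apply: eq_integral => x _; rewrite /f/= -EFinM /g -expRD.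
    rewrite (col_of_tuple_cons (x, t)) (@qform_schur _ n)//; last first.
      by rewrite gt_eqF.
    congr (expR _)%:E; rewrite -/(v t) addrA.
    by rewrite mulrDl opprD.
  apply/measurable_EFinP; apply: measurableT_comp => //.
  apply: measurableT_comp => //; apply: measurable_funM => //.
  apply: measurable_funM => //; apply: measurable_funX => //.
  exact: measurable_funD.
under eq_integral do rewrite inner.
rewrite ge0_integralZl_EFin ?sqrtr_ge0//; last 2 first.
- by move=> t _; rewrite lee_fin.
- by apply/measurable_EFinP; exact: measurable_expR_qform.
rewrite [X in (_ * X)%E](IH _ _ (sympd_schur (n := n) SS)).
rewrite -EFinM -sqrtrM ?divr_ge0 ?mulr_ge0 ?pi_ge0 ?ltW//.
rewrite (@det_schur _ n S) ?gt_eqF// exprS invfM; congr (Num.sqrt _)%:E.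
by rewrite mulrACA.
Qed.

End gaussian_integral.

(** * Completing the square and the importance weights *)

Section importance_weight.
Context {R : realType}.

Lemma qformB n (S : 'M[R]_n) (x u : 'cV[R]_n) : S^T = S ->
  qform S (x - u) = qform S x - 2 * (x^T *m (S *m u)) 0 0 + qform S u.
Proof.
move=> sS; have trB : (x - u)^T = x^T - u^T by rewrite linearB.
rewrite /qform trB mulmxBr !mulmxBl -!mulmxA.
have -> : u^T *m (S *m x) = x^T *m (S *m u).
  by rewrite [LHS]mx11_scalar -tr_scalar_mx -mx11_scalar !trmx_mul trmxK sS mulmxA.
move: (x^T *m (S *m x)) (x^T *m (S *m u)) (u^T *m (S *m u)) => a c d.
by rewrite !mxE; ring.
Qed.

Context (M N : nat) (A : 'M[R]_(M, N)) (b : 'cV[R]_M) (Gprior : 'M[R]_N).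
Context (hGprior : sympd Gprior).
Context (amu asigma bmu bsigma : R) (Ghat : R * R -> 'M[R]_N).
Context (theta : R * R).
Context (htheta : quadrant theta) (hGhat : sympd (Ghat theta)).

Let P := precision_cond A Gprior theta.
(** The exact conditional mean: [mean_hat] with the exact covariance in place of [Ghat theta]. *)
Let mean_cond := theta.1 *: (invmx P *m A^T *m b).

(** The Gram term is only semidefinite; definiteness comes from the prior term, since [theta.2] is
    positive. *)
Lemma sympd_precision_cond : sympd P.
Proof.
have [mu0 sigma0] := htheta.
apply: sympdD_psd => [|v|].
- by rewrite linearZ/= trmx_mul trmxK.
- rewrite /qform -scalemxAr -scalemxAl mxE mulr_ge0 ?(ltW mu0)//.
  exact: qform_gram_ge0.
- exact/sympdZ/sympd_inv.
Qed.

Lemma l2norm_residual_sqr (x : 'cV[R]_N) :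
  l2norm (A *m x - b) ^+ 2 =
  qform (A^T *m A) x - 2 * (x^T *m (A^T *m b)) 0 0 + l2norm b ^+ 2.
Proof.
have qform1 n (v : 'cV[R]_n) : l2norm v ^+ 2 = qform 1%:M v.
  by rewrite l2norm_sqr /qform mulmx1.
rewrite !qform1 qformB ?tr_scalar_mx// mul1mx trmx_mul -mulmxA.
by congr (_ - _ + _); rewrite /qform mulmx1 trmx_mul !mulmxA.
Qed.

(** Stated for a general [S] because it serves both the exact and the approximate precision. *)
Lemma mulmx_mean (S : 'M[R]_N) : S \in unitmx ->
  S *m (theta.1 *: (invmx S *m A^T *m b)) = theta.1 *: (A^T *m b).
Proof. by move=> uS; rewrite -scalemxAr -!mulmxA mulKVmx. Qed.

Lemma qform_mean (S : 'M[R]_N) : sympd S ->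
  qform S (theta.1 *: (invmx S *m A^T *m b)) =
  theta.1 ^+ 2 * (b^T *m A *m invmx S *m A^T *m b) 0 0.
Proof.
move=> SS; rewrite /qform -mulmxA mulmx_mean ?sympd_unit//.
rewrite -scalemxAr [X in X *m _]linearZ/= -scalemxAl scalerA mxE -expr2.
by rewrite !trmx_mul trmxK (invmx_sym SS.1) !mulmxA.
Qed.

(** The factor free of [x] once the square around [mean_cond] is completed; [qform P mean_cond / 2]
    offsets the constant term of that square. *)
Definition kernel_const : R :=
  theta.1 `^ (M%:R / 2) * theta.2 `^ (N%:R / 2) *
  hyperprior amu asigma bmu bsigma theta *
  expR (qform P mean_cond / 2 - theta.1 / 2 * l2norm b ^+ 2).

Lemma posterior_kernelE (x : 'cV[R]_N) :
  posterior_kernel A b Gprior amu asigma bmu bsigma x theta =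
  kernel_const * expR (- (qform P (x - mean_cond) / 2)).
Proof.
have PP := sympd_precision_cond.
rewrite /posterior_kernel /kernel_const -[RHS]mulrA -expRD; congr (_ * expR _).
rewrite (qformB _ _ PP.1) mulmx_mean ?sympd_unit// l2norm_residual_sqr.
have -> : qform P x = theta.1 * qform (A^T *m A) x +
    theta.2 * (x^T *m invmx Gprior *m x) 0 0.
  rewrite /qform /P /precision_cond mulmxDr mulmxDl -!scalemxAr -!scalemxAl.
  by rewrite mxE; congr (_ + _); rewrite mxE.
have -> : (x^T *m (theta.1 *: (A^T *m b))) 0 0 =
    theta.1 * (x^T *m (A^T *m b)) 0 0.
  by rewrite -scalemxAr mxE.
by field.
Qed.

(* Holds whatever the value of the normalizing integral, as posterior enters
   both sides. *)
Lemma posteriorE (x : 'cV[R]_N) :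
  posterior A b Gprior amu asigma bmu bsigma x theta =
  posterior A b Gprior amu asigma bmu bsigma mean_cond theta *
  expR (- (qform P (x - mean_cond) / 2)).
Proof.
(* At [mean_cond] the exponential is 1, so the posterior there is the constant factor. *)
have qform0 : qform P 0 = 0 by rewrite /qform mulmx0 mxE.
rewrite /posterior !posterior_kernelE subrr qform0 mul0r oppr0 expR0 mulr1.
by rewrite [RHS]mulrAC.
Qed.

Lemma marginalE :
  marginal A b Gprior amu asigma bmu bsigma theta =
  posterior A b Gprior amu asigma bmu bsigma mean_cond theta *
  Num.sqrt ((2 * pi) ^+ N / \det P).
Proof.
have PP := sympd_precision_cond.
have intE := integral_gauss_qform mean_cond PP.
rewrite /marginal; under eq_Rintegral do rewrite posteriorE.
rewrite RintegralZl//; first by rewrite /Rintegral intE.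
(* Finiteness of the Gaussian integral gives the integrability needed to pull the constant out. *)
apply/integrableP; split.
  by apply/measurable_EFinP; exact: measurable_expR_qform.
under eq_integral do rewrite /= ger0_norm ?expR_ge0//.
by rewrite intE ltry.
Qed.

Lemma posterior_importance_ratio (x : 'cV[R]_N) :
  posterior A b Gprior amu asigma bmu bsigma x theta /
    importance_pdf A b Ghat x theta =
  z_weight A b Gprior Ghat x theta *
    marginal A b Gprior amu asigma bmu bsigma theta.
Proof.
have PP := sympd_precision_cond.
have [dP dG] := (det_sympd_gt0 PP, det_sympd_gt0 hGhat).
have GG := sympd_inv hGhat.
set G' := invmx (Ghat theta) in GG *.
(* Reading [Ghat theta] as the inverse of [G'] gives the approximate mean the shape used in
   [mulmx_mean] and [qform_mean]. *)
have mE : mean_hat A b Ghat theta = theta.1 *: (invmx G' *m A^T *m b).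
  by rewrite invmxK.
rewrite marginalE posteriorE /importance_pdf /gaussian_pdf -/(qform G' _).
rewrite /z_weight /weight /weight_M1 -/P -/G'.
set c := posterior _ _ _ _ _ _ _ _ _.
(* The exponent of [weight_M1] is half the difference of the two forms, each taken at its own
   mean. *)
have -> : theta.1 ^+ 2 / 2 *
    (b^T *m A *m (cov_cond A Gprior theta - Ghat theta) *m A^T *m b) 0 0 =
    (qform P mean_cond - qform G' (mean_hat A b Ghat theta)) / 2.
  rewrite mE !qform_mean// invmxK mulmxBr !mulmxBl -/(cov_cond A Gprior theta).
  move: (b^T *m A *m cov_cond A Gprior theta *m A^T *m b) => c1.
  move: (b^T *m A *m Ghat theta *m A^T *m b) => c2.
  by rewrite !mxE; field.
have -> : (x^T *m (P - G') *m x) 0 0 = qform P x - qform G' x.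
  by rewrite /qform mulmxBr mulmxBl mxE; congr (_ + _); rewrite mxE.
(* The normalizer of the approximate Gaussian splits into the root in [weight_M1] and the Gaussian
   integral in the marginal. *)
have sqrtE : Num.sqrt ((2 * pi) ^+ N * \det (Ghat theta)) =
    Num.sqrt (\det (Ghat theta) * \det P) * Num.sqrt ((2 * pi) ^+ N / \det P).
  rewrite -sqrtrM ?mulr_ge0 ?ltW//; congr Num.sqrt.
  by field; rewrite gt_eqF.
rewrite !invfM !invrK -!expRN sqrtE opprK.
set s := Num.sqrt (_ * _); set t := Num.sqrt _.
(* The precisions P and G' send their respective means to the same vector
   mu A^T b, so the terms linear in x cancel. *)
have expE : expR (- (qform P (x - mean_cond) / 2)) *
    expR (qform G' (x - mean_hat A b Ghat theta) / 2) =
    expR (- ((qform P x - qform G' x) / 2)) *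
    expR (- ((qform P mean_cond - qform G' (mean_hat A b Ghat theta)) / 2)).
  rewrite -!expRD; congr expR.
  rewrite (qformB _ _ PP.1) (qformB _ _ GG.1) mE !mulmx_mean ?sympd_unit//.
  by field.
transitivity (c * (expR (- (qform P (x - mean_cond) / 2)) *
    expR (qform G' (x - mean_hat A b Ghat theta) / 2)) * (s * t)); first by ring.
by rewrite expE; ring.
Qed.

(** The marginal does not depend on the sample, so it factors out of the average. *)
Lemma marginal_ISE K (xs : 'I_K -> 'cV[R]_N) :
  marginal_IS A b Gprior amu asigma bmu bsigma Ghat xs theta =
  z_avg A b Gprior Ghat xs theta *
    marginal A b Gprior amu asigma bmu bsigma theta.
Proof.
rewrite /marginal_IS /z_avg -mulrA mulr_suml; congr (_ * _).
by apply: eq_bigr => j _; exact: posterior_importance_ratio.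
Qed.

End importance_weight.

Theorem proposition3 (R : realType) (M N : nat)
    (A : 'M[R]_(M, N)) (b : 'cV[R]_M) (Gprior : 'M[R]_N)
    (hGprior : sympd Gprior)
    (amu asigma bmu bsigma : R)
    (hamu : 0 < amu) (hasigma : 0 < asigma)
    (hbmu : 0 < bmu) (hbsigma : 0 < bsigma)
    (Ghat : R * R -> 'M[R]_N)
    (hGhat : forall theta, quadrant theta -> sympd (Ghat theta))
    (r : R * R -> R * R -> R)
    (hr : forall theta, quadrant theta ->
      is_pdf_on lebesgue2 (quadrant) (fun theta' => r theta' theta))
    (K : nat) (hK : (1 <= K)%N)
    (theta theta' : R * R)
    (htheta : quadrant theta) (htheta' : quadrant theta')
    (hrpos : 0 < r theta' theta)
    (xs xs' : 'I_K -> 'cV[R]_N) :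
  rho4 A b Gprior amu asigma bmu bsigma Ghat r xs' theta' xs theta =
  Num.min 1
    (z_avg A b Gprior Ghat xs' theta' *
       marginal A b Gprior amu asigma bmu bsigma theta' * r theta theta' /
     (z_avg A b Gprior Ghat xs theta *
       marginal A b Gprior amu asigma bmu bsigma theta * r theta' theta)).
Proof.
by rewrite /rho4 !marginal_ISE//; exact: hGhat.
Qed.
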